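(* For every $w\in\mathcal{W}$, $$\ell_{\Pi_0}(w)=|\mathrm{ht}(\epsilon+T(w))|-\mathrm{sgn}\big(\mathrm{ht}(\epsilon+T(w))\big)\,t,$$ where $t=\delta_{\varepsilon(w),1}$ (Kronecker delta) and $\mathrm{sgn}(\mathrm{ht}(\epsilon+T(w)))$ is the sign of the (nonzero) integer $\mathrm{ht}(\epsilon+T(w))$.
   Context: Let $A$ be a free abelian group of rank $\nu+1$ with a symmetric positive semidefinite bi-additive form $(\cdot,\cdot):A\times A\to\mathbb{Q}$ whose radical is $\Lambda=\{\alpha:(\alpha,A)=0\}$; let $\{\epsilon,\sigma_1,\dots,\sigma_\nu\}$ be a $\mathbb{Z}$-basis of $A$ with $\{\sigma_1,\dots,\sigma_\nu\}$ a $\mathbb{Z}$-basis of $\Lambda$ and $(\epsilon,\epsilon)=2$. Let $\tilde R=\{k\epsilon+\sigma:k\in\{0,\pm1\},\sigma\in\Lambda\}$ and $\tilde R^\times=\pm\epsilon+\Lambda$. For $\alpha\in\tilde R^\times$, $w_\alpha\in\mathrm{Aut}(A)$ is $w_\alpha(\beta)=\beta-\frac{2(\beta,\alpha)}{(\alpha,\alpha)}\alpha$, and $\mathcal{W}=\langle w_\alpha:\alpha\in\tilde R^\times\rangle$. Each $\alpha\in A$ is written $\alpha=\mathrm{sgn}(\alpha)\epsilon+p(\alpha)$ with $\mathrm{sgn}(\alpha)\in\mathbb{Z}$, $p(\alpha)\in\Lambda$. For $w=w_{\gamma_1}\cdots w_{\gamma_n}\in\mathcal{W}$ with $\gamma_i\in\tilde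 R^\times$, put $\varepsilon(w)=(-1)^n$ and $T(w)=\sum_{i=1}^n(-1)^{n-i}\mathrm{sgn}(\gamma_i)p(\gamma_i)\in\Lambda$; both are independent of the expression. For $\sigma=\sum_{i=1}^\nu m_i\sigma_i\in\Lambda$ put $m^+=\sum_{m_i>0}m_i$, $m^-=\sum_{m_i<0}m_i$, and $\mathrm{ht}_{\mathfrak{B}^0}(\sigma)=2m^+$ if $m^+\ge|m^-|$, $=2m^-$ if $m^+<|m^-|$. For $\alpha=k\epsilon+\sigma\in\tilde R$, $\mathrm{ht}(\alpha)=k-\mathrm{ht}_{\mathfrak{B}^0}(\sigma)$ if $k=-1$ and $m^+=|m^-|$, and $\mathrm{ht}(\alpha)=k+\mathrm{ht}_{\mathfrak{B}^0}(\sigma)$ otherwise. The fundamental root basis is $\Pi_0=\{\alpha_0=\epsilon,\ \alpha_1=\sigma_1-\epsilon,\dots,\alpha_\nu=\sigma_\nu-\epsilon\}$; the reflections $w_{\alpha_0},\dots,w_{\alpha_\nu}$ generate $\mathcal{W}$. For $w\in\mathcal{W}$, $\ell_{\Pi_0}(w)$ is the smallest $k\ge0$ such that $w=w_{\beta_1}\cdots w_{\beta_k}$ with all $\beta_j\in\Pi_0$ ($\ell_{\Pi_0}(1)=0$). *)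

(* Defs.v *)
From HB Require Import structures.
From mathcomp Require Import all_boot all_order all_algebra.
From mathcomp Require Import boolp classical_sets.
From mathcomp Require Import ring lra zify.
Set Implicit Arguments.
Unset Strict Implicit.
Unset Printing Implicit Defensive.
Import Order.TTheory GRing.Theory Num.Theory.
Local Open Scope ring_scope.

Section Lattice.
Context (A : zmodType).

Definition zcomb (I : finType) (e : I -> A) (m : {ffun I -> int}) : A :=
  \sum_i e i *~ m i.

Definition zbasis (S : A -> Prop) (I : finType) (e : I -> A) : Prop :=
  (forall m, S (zcomb e m)) /\ (forall a, S a -> exists! m, a = zcomb e m).

Definition radical (form : A -> A -> rat) (a : A) : Prop :=
  forall b, form a b = 0.

Context (nu : nat).

(* The basis of A is indexed by [option 'I_nu]: [None] stands for epsilon and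
   [Some i] for the i-th element of the basis of the radical. *)
Record A1_lattice (form : A -> A -> rat) (eps : A) (sigma : 'I_nu -> A) : Prop
  := A1Lattice {
  formC : forall a b, form a b = form b a;
  formDl : forall a b c, form (a + b) c = form a c + form b c;
  formDr : forall a b c, form a (b + c) = form a b + form a c;
  form_ge0 : forall a, 0 <= form a a;
  zbasis_lattice :
    zbasis (fun=> True) (fun o : option 'I_nu => oapp sigma eps o);
  zbasis_radical : zbasis (radical form) sigma;
  form_eps : form eps eps = 2
}.

Context (form : A -> A -> rat) (eps : A) (sigma : 'I_nu -> A).

Definition Rx (a : A) : Prop :=
  exists2 tau, radical form tau & a = eps + tau \/ a = - eps + tau.

(* The floor only turns the rational Cartan number into an integer, so that it
   can act on A: on Rx that number is an integer, see [cartanE]. *)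
Definition cartan (b a : A) : int := Num.floor (2 * form b a / form a a).

Definition refl (a b : A) : A := b - a *~ cartan b a.

(* The subgroup of Aut(A) generated by the reflections in Rx. *)
Inductive weyl : (A -> A) -> Prop :=
| weyl_refl a : Rx a -> weyl (refl a)
| weyl_id : weyl id
| weyl_comp f g : weyl f -> weyl g -> weyl (f \o g)
| weyl_inv f g : weyl f -> cancel f g -> cancel g f -> weyl g.

Definition word (gs : seq A) : A -> A :=
  foldr (fun g f => refl g \o f) id gs.

Definition expression (S : A -> Prop) (w : A -> A) (gs : seq A) : Prop :=
  (forall g, g \in gs -> S g) /\ w =1 word gs.

(* a = sgn(a) epsilon + p(a), with p(a) in the radical *)
Definition splitting (a : A) : int * A :=
  xget (0, 0) (fun c => radical form c.2 /\ a = eps *~ c.1 + c.2).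
Definition sgnA (a : A) : int := (splitting a).1.
Definition pA (a : A) : A := (splitting a).2.

(* gs`_i is the factor gamma_(i+1), whence the exponent n - (i + 1). *)
Definition Tword (gs : seq A) : A :=
  \sum_(i < size gs)
    pA gs`_i *~ ((-1) ^+ (size gs - i.+1) * sgnA gs`_i).

(* Both functions below do not depend on the chosen expression, see [signWE]
   and [TWE]. *)
Definition an_expression (w : A -> A) : seq A := xget [::] (expression Rx w).
Definition signW (w : A -> A) : int := (-1) ^+ size (an_expression w).
Definition TW (w : A -> A) : A := Tword (an_expression w).

Definition coords (tau : A) : {ffun 'I_nu -> int} :=
  xget 0 (fun m => tau = zcomb sigma m).
Definition mpos (tau : A) : int :=
  \sum_(i | 0 < coords tau i) coords tau i.
Definition mneg (tau : A) : int :=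
  \sum_(i | coords tau i < 0) coords tau i.
Definition ht0 (tau : A) : int :=
  if `|mneg tau| <= mpos tau then 2 * mpos tau else 2 * mneg tau.
(* Meaningful when sgn(a) is 0, 1 or -1. *)
Definition ht (a : A) : int :=
  if (sgnA a == -1) && (mpos (pA a) == `|mneg (pA a)|)
  then sgnA a - ht0 (pA a) else sgnA a + ht0 (pA a).

Definition Pi0 (a : A) : Prop := a = eps \/ exists i, a = sigma i - eps.

Definition is_length (w : A -> A) (k : nat) : Prop :=
  (exists2 gs, expression Pi0 w gs & size gs = k) /\
  (forall gs, expression Pi0 w gs -> (k <= size gs)%N).

Section Theory.
Hypothesis hA : A1_lattice form eps sigma.

Lemma form0l b : form 0 b = 0.
Proof. by have := formDl hA 0 0 b; rewrite addr0; lra. Qed.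

Lemma formNl a b : form (- a) b = - form a b.
Proof. by have := formDl hA a (- a) b; rewrite subrr form0l; lra. Qed.

Lemma formMnl a b n : form (a *+ n) b = form a b *+ n.
Proof.
by elim: n => [|n IH]; rewrite ?mulr0n ?form0l // !mulrS (formDl hA) IH.
Qed.

Lemma formMzl a b k : form (a *~ k) b = form a b * k%:~R.
Proof.
rewrite mulrzr; case: k => n; first by rewrite -!pmulrn formMnl.
by rewrite NegzE !mulrNz -!pmulrn formNl formMnl.
Qed.

Lemma radicalD a b : radical form a -> radical form b -> radical form (a + b).
Proof. by move=> ra rb c; rewrite (formDl hA) ra rb addr0. Qed.

Lemma radicalN a : radical form a -> radical form (- a).
Proof. by move=> ra c; rewrite formNl ra oppr0. Qed.

Lemma radicalMz a k : radical form a -> radical form (a *~ k).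
Proof. by move=> ra c; rewrite formMzl ra mul0r. Qed.

Lemma radicalr a b : radical form a -> form b a = 0.
Proof. by move=> ra; rewrite (formC hA) ra. Qed.

Lemma form_split_eps k tau : radical form tau ->
  form (eps *~ k + tau) eps = 2 * k%:~R.
Proof.
by move=> rt; rewrite (formDl hA) formMzl (form_eps hA) rt addr0.
Qed.

Lemma splittingE k tau : radical form tau ->
  splitting (eps *~ k + tau) = (k, tau).
Proof.
move=> rt; apply: xget_unique => //= -[l s] /= [rs e].
have := congr1 (form^~ eps) e.
rewrite !form_split_eps // => /(mulfI _) kl.
have {}kl : k = l by apply: (@intr_inj rat); apply: kl.
by subst l; move/addrI: e => ->.
Qed.

Lemma splittingP a :
  radical form (pA a) /\ a = eps *~ sgnA a + pA a.
Proof.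
rewrite /pA /sgnA.
have [_ /(_ a I) [m [am _]]] := zbasis_lattice hA.
have [rs _] := zbasis_radical hA.
have -> : a = eps *~ m None + zcomb sigma [ffun i => m (Some i)].
  rewrite {1}am /zcomb (bigD1 None) //=; congr (_ + _).
  rewrite (reindex_omap Some id) /=; last by case.
  by apply: eq_big => [i|i _]; rewrite ?eqxx ?ffunE.
by rewrite splittingE /=; [split=> //; apply: rs|apply: rs].
Qed.

Lemma radical_p a : radical form (pA a).
Proof. by case: (splittingP a). Qed.

Lemma sgnAE k tau : radical form tau -> sgnA (eps *~ k + tau) = k.
Proof. by move=> rt; rewrite /sgnA splittingE. Qed.

Lemma pAE k tau : radical form tau -> pA (eps *~ k + tau) = tau.
Proof. by move=> rt; rewrite /pA splittingE. Qed.

Lemma RxP a : Rx a -> sgnA a = 1 \/ sgnA a = -1.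
Proof.
move=> [tau rt [->|->]]; [left; rewrite -[eps]mulr1z|right].
  by rewrite sgnAE.
by rewrite -[- eps](mulrN1z eps) sgnAE.
Qed.

Lemma form_sgn a b : form a b = 2 * (sgnA a)%:~R * (sgnA b)%:~R.
Proof.
have [ra ea] := splittingP a; have [rb eb] := splittingP b.
rewrite {1}ea (formDl hA) ra addr0 formMzl {1}eb (formDr hA) (radicalr _ rb) addr0.
by rewrite (formC hA) formMzl (form_eps hA); ring.
Qed.

Lemma cartan_val a b : Rx a -> 
  2 * form b a / form a a = (2 * sgnA b * sgnA a)%:~R :> rat.
Proof.
by rewrite !form_sgn !intrM => /RxP [] ->; rewrite ?mulrN1z; field.
Qed.

Lemma cartanE a b : Rx a -> (cartan b a)%:~R = 2 * form b a / form a a :> rat.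
Proof. by move=> /[dup] ra /cartan_val; rewrite /cartan => ->; rewrite intrKfloor. Qed.

Lemma reflE a b : Rx a -> refl a b = b - a *~ (2 * sgnA b * sgnA a).
Proof. by move=> ra; rewrite /refl /cartan cartan_val // intrKfloor. Qed.

Lemma refl_split a b : Rx a ->
  refl a b = eps *~ (- sgnA b) + (pA b - pA a *~ (2 * sgnA b * sgnA a)).
Proof.
move=> ra; rewrite reflE //.
have [rpa ea] := splittingP a; have [rpb eb] := splittingP b.
rewrite {1}eb {1}ea mulrzDl -mulrzA opprD addrACA; congr (_ + _).
by rewrite -mulrzBr; congr (_ *~ _); case: (RxP ra) => ->; ring.
Qed.

Lemma sgn_refl a b : Rx a -> sgnA (refl a b) = - sgnA b.
Proof.
move=> ra; rewrite refl_split // sgnAE //.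
exact: radicalD (radical_p _) (radicalN (radicalMz _ (radical_p _))).
Qed.

Lemma p_refl a b : Rx a -> pA (refl a b) = pA b - pA a *~ (2 * sgnA b * sgnA a).
Proof.
move=> ra; rewrite refl_split // pAE //.
exact: radicalD (radical_p _) (radicalN (radicalMz _ (radical_p _))).
Qed.

Lemma reflK a : Rx a -> involutive (refl a).
Proof.
move=> ra b; rewrite [LHS]reflE // sgn_refl // reflE //.
by rewrite mulrN mulNr mulrNz opprK subrK.
Qed.

Lemma word_cat s1 s2 : word (s1 ++ s2) = word s1 \o word s2.
Proof. by elim: s1 => //= g s1 ->. Qed.

Lemma word_revK gs : (forall g, g \in gs -> Rx g) ->
  cancel (word gs) (word (rev gs)).
Proof.
elim: gs => [|g gs IH] // hgs b.
rewrite rev_cons -cats1 word_cat /= reflK ?IH //; last by apply: hgs; rewrite mem_head.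
by move=> x xg; apply: hgs; rewrite inE xg orbT.
Qed.

Lemma weylP w : weyl w <-> exists gs, expression Rx w gs.
Proof.
split=> [|[gs [hgs /funext ->]]]; last first.
  elim: gs hgs => [|g gs IH] hgs /=; first exact: weyl_id.
  apply: weyl_comp; first by apply/weyl_refl/hgs/mem_head.
  by apply: IH => x xg; apply: hgs; rewrite inE xg orbT.
elim=> [a ra||f g _ [s [hs ef]] _ [t [ht' eg]]|f g _ [s [hs ef]] fg gf].
- by exists [:: a]; split=> // x; rewrite inE => /eqP ->.
- by exists [::].
- exists (s ++ t); split; last by move=> x; rewrite word_cat /= ef eg.
  by move=> x; rewrite mem_cat => /orP [/hs|/ht'].
- exists (rev s); split; first by move=> x; rewrite mem_rev => /hs.
  by move=> x; rewrite -{2}(gf x) ef word_revK.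
Qed.

Lemma Tword_cons g gs :
  Tword (g :: gs) = pA g *~ ((-1) ^+ size gs * sgnA g) + Tword gs.
Proof. by rewrite /Tword big_ord_recl /= subSS subn0. Qed.

Lemma Tword_radical gs : radical form (Tword gs).
Proof.
elim: gs => [|g gs IH]; first by rewrite /Tword big_ord0 => b; rewrite form0l.
rewrite Tword_cons; apply: radicalD => //.
exact/radicalMz/radical_p.
Qed.

Lemma word_eps gs : (forall g, g \in gs -> Rx g) ->
  word gs eps = eps *~ (-1) ^+ size gs + Tword gs *~ (- 2).
Proof.
elim: gs => [|g gs IH] hgs.
  by rewrite /Tword big_ord0 mul0rz addr0 mulr1z.
have rT := @radicalMz _ (- 2) (Tword_radical gs).
rewrite /= IH; last by move=> x xg; apply: hgs; rewrite inE xg orbT.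
rewrite refl_split; last by apply: hgs; rewrite mem_head.
rewrite sgnAE // pAE // Tword_cons mulrzDl -mulrzA exprS mulN1r; congr (_ + _).
rewrite addrC -mulrNz; congr (_ *~ _ + _); ring.
Qed.

Lemma zcomb_inj : injective (zcomb sigma).
Proof.
move=> m n e; have [h1 h2] := zbasis_radical hA.
by have [k [_ hk]] := h2 _ (h1 m); rewrite -(hk m) // -(hk n).
Qed.

Lemma radical_mulz_inj k s t : k != 0 -> radical form s -> radical form t ->
  s *~ k = t *~ k -> s = t.
Proof.
move=> k0 rs rt; have [_ h] := zbasis_radical hA.
have [m [-> _]] := h _ rs; have [n [-> _]] := h _ rt.
have E q : zcomb sigma q *~ k = zcomb sigma [ffun i => q i * k].
  rewrite /zcomb mulrz_suml; apply: eq_bigr => i _.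
  by rewrite ffunE mulrzA.
rewrite !E => /zcomb_inj /ffunP mn; congr zcomb; apply/ffunP => i.
by have := mn i; rewrite !ffunE => /(mulIf k0).
Qed.

Lemma expression_indep w gs hs : expression Rx w gs -> expression Rx w hs ->
  (-1) ^+ size gs = (-1) ^+ size hs :> int /\ Tword gs = Tword hs.
Proof.
move=> [hg eg] [hh eh]; have := eg eps; rewrite eh !word_eps // => e.
have rT s := @radicalMz _ (- 2) (Tword_radical s).
split; first by have := congr1 sgnA e; rewrite !sgnAE.
have := congr1 pA e; rewrite !pAE // => /radical_mulz_inj -> //;
  exact: Tword_radical.
Qed.

Lemma signWE w gs : expression Rx w gs -> signW w = (-1) ^+ size gs.
Proof.
by move=> h; have [] := expression_indep (xgetI [::] h) h.
Qed.

Lemma TWE w gs : expression Rx w gs -> TW w = Tword gs.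
Proof.
by move=> h; have [] := expression_indep (xgetI [::] h) h.
Qed.

Lemma coordsE m : coords (zcomb sigma m) = m.
Proof. by apply: xget_unique => // n /zcomb_inj. Qed.

Lemma ht_eps_neq0 tau : radical form tau -> ht (eps + tau) != 0.
Proof.
move=> rt; rewrite -[eps]mulr1z /ht sgnAE // pAE //= /ht0.
by case: ifP => _; lia.
Qed.

End Theory.
End Lattice.

(* Main.v *)
Require Import Defs.
From mathcomp Require Import all_boot all_order all_algebra.
From mathcomp Require Import zify.
Import Order.TTheory GRing.Theory Num.Theory.
Local Open Scope ring_scope.

(** An element w of the Weyl group is the identity on the radical and sends
    eps to sign(w) eps - 2 T(w), so it is determined by its sign and by
    T(w) (lemma [word_split]).  Hence the length of w is the least n of the
    right parity for which some word of n fundamental roots has invariant T(w).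

    Put c(gamma) = sgn(gamma) p(gamma): it is 0 for gamma = eps and - sigma_i for
    gamma = sigma_i - eps.  For a word of n fundamental roots, T is the
    alternating sum of the c(gamma_j), the last one counted positively; thus
    uphalf n places contribute 0 or - sigma_i, each with a free choice of i, and
    the other n./2 places contribute 0 or sigma_i.  Therefore tau in the radical
    is the invariant of a word of length n exactly when m^+ <= n./2 and
    |m^-| <= uphalf n, where m^+ and m^- are the sums of the positive and of the
    negative coordinates of tau (lemma [Pi0_TwordP]).

    The least even n with this property is 2 max(m^+, |m^-|) and the least odd
    one is max(2 m^+ + 1, 2 |m^-| - 1).  On the other hand ht(eps + tau) is
    1 + 2 m^+ if |m^-| <= m^+, and 1 - 2 |m^-| otherwise, so the two minima are
    |ht| - sgn(ht) and |ht|. *)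

Section FundamentalWords.
Set Implicit Arguments.
Unset Strict Implicit.

(** * Positive parts of integer vectors *)

Section PositivePart.
Context (I : finType).
Implicit Types (m : {ffun I -> int}) (i : I).

(** On the coordinates of tau this is the m^+ of the height function, and on
    their opposites it is |m^-|. *)
Definition pospart m : nat := \sum_i `|Num.max (m i) 0|%N.

Definition unitvec i : {ffun I -> int} := [ffun j => (j == i)%:Z].

Lemma pospart_update m m' i : (forall j, j != i -> m j = m' j) ->
  (pospart m + `|Num.max (m' i) 0| = pospart m' + `|Num.max (m i) 0|)%N.
Proof.
move=> mm'; rewrite /pospart (bigD1 i) // [in RHS](bigD1 i) //=.
rewrite (eq_bigr (fun j => `|Num.max (m' j) 0|%N)); last by move=> j /mm' ->.
rewrite [LHS]addnAC [RHS]addnAC; congr (_ + _)%N; exact: addnC.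
Qed.

Lemma sum_gt0E m : \sum_(i | 0 < m i) m i = (pospart m)%:Z.
Proof.
rewrite -[RHS]natz natr_sum big_mkcond; apply: eq_bigr => i _.
by rewrite natz; case: ifP; lia.
Qed.

Lemma sum_lt0E m : \sum_(i | m i < 0) m i = - (pospart (- m))%:Z.
Proof.
rewrite -sum_gt0E -sumrN; apply: eq_big => i; rewrite ffunE ?opprK //.
by rewrite oppr_gt0.
Qed.

(** The map m |-> unitvec i - m is the effect of prefixing one fundamental
    reflection to a word, hence the interest in how it moves both positive
    parts. *)
Lemma unitvec_sub_update m i :
  (pospart (unitvec i - m)%R + `|Num.max (- m i)%R 0| =
     pospart (- m)%R + `|Num.max (1 - m i)%R 0|)%N /\
  (pospart (- (unitvec i - m))%R + `|Num.max (m i) 0| =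
     pospart m + `|Num.max (m i - 1)%R 0|)%N.
Proof.
split.
- have := @pospart_update (unitvec i - m) (- m) i.
  by rewrite !ffunE eqxx; apply=> j /negPf ji; rewrite !ffunE ji add0r.
- have := @pospart_update (- (unitvec i - m)) m i.
  rewrite -(opprB 1 (m i)) !ffunE eqxx; apply=> j /negPf ji.
  by rewrite !ffunE ji add0r opprK.
Qed.

Lemma pospart_unitvec_sub_le m i :
  (pospart (unitvec i - m)%R <= (pospart (- m)%R).+1)%N /\
  (pospart (- (unitvec i - m))%R <= pospart m)%N.
Proof. by have := unitvec_sub_update m i; lia. Qed.

Lemma pospart_unitvec_sub_eq m i : 0 < m i ->
  pospart (unitvec i - m) = pospart (- m) /\
  (pospart (- (unitvec i - m))).+1 = pospart m.
Proof. by have := unitvec_sub_update m i; lia. Qed.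

Lemma pospart_gt0 m : (0 < pospart m)%N -> exists i, 0 < m i.
Proof.
rewrite lt0n sum_nat_eq0 negb_forall => /existsP [i].
by rewrite negb_imply /= => hi; exists i; lia.
Qed.

Lemma pospart_eq0 m : pospart m = 0%N -> pospart (- m) = 0%N -> m = 0.
Proof.
move=> /eqP; rewrite sum_nat_eq0 => /forallP m0.
move=> /eqP; rewrite sum_nat_eq0 => /forallP m1.
by apply/ffunP => i; have := m0 i; have := m1 i; rewrite !ffunE /=; lia.
Qed.

End PositivePart.

(** * Coordinates on the radical and the height *)

Context (nu : nat) (A : zmodType) (form : A -> A -> rat).
Context (eps : A) (sigma : 'I_nu -> A) (hA : A1_lattice form eps sigma).
Implicit Types (m u : {ffun 'I_nu -> int}) (gs : seq A).

Lemma zcombD m u : zcomb sigma (m + u) = zcomb sigma m + zcomb sigma u.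
Proof.
by rewrite /zcomb -big_split; apply: eq_bigr => i _; rewrite ffunE mulrzDr.
Qed.

Lemma zcombN m : zcomb sigma (- m) = - zcomb sigma m.
Proof.
by rewrite /zcomb -sumrN; apply: eq_bigr => i _; rewrite ffunE mulrNz.
Qed.

Lemma zcomb0 : zcomb sigma 0 = 0.
Proof. by apply: big1 => i _; rewrite ffunE. Qed.

Lemma zcomb_unitvec i : zcomb sigma (unitvec i) = sigma i.
Proof.
rewrite /zcomb (bigD1 i) //= ffunE eqxx mulr1z big1 ?addr0 // => j /negPf ji.
by rewrite ffunE ji.
Qed.

Lemma radical_zcomb m : radical form (zcomb sigma m).
Proof. by have [] := zbasis_radical hA. Qed.

Lemma radical_sigma i : radical form (sigma i).
Proof. by rewrite -zcomb_unitvec; apply: radical_zcomb. Qed.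

Lemma zcomb_coords tau : radical form tau -> zcomb sigma (coords sigma tau) = tau.
Proof.
by have [_ h] := zbasis_radical hA => /h [m [-> _]]; rewrite (coordsE hA).
Qed.

Lemma mpos_zcomb m : mpos sigma (zcomb sigma m) = (pospart m)%:Z.
Proof. by rewrite /mpos (coordsE hA); exact: sum_gt0E. Qed.

Lemma mneg_zcomb m : mneg sigma (zcomb sigma m) = - (pospart (- m))%:Z.
Proof. by rewrite /mneg (coordsE hA); exact: sum_lt0E. Qed.

Lemma ht_eps_zcomb m : ht form eps sigma (eps + zcomb sigma m) =
  if (pospart (- m)%R <= pospart m)%N then 1 + 2 * (pospart m)%:Z
  else 1 - 2 * (pospart (- m))%:Z.
Proof.
have rm := radical_zcomb m.
rewrite /ht -[eps in eps + _]mulr1z (sgnAE hA) // (pAE hA) //= /ht0.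
by rewrite mpos_zcomb mneg_zcomb normrN lez_nat mulrN; case: ifP.
Qed.

(** * Words in the fundamental roots *)

(** Reflections fix the radical and change the sign of the eps-coefficient, so a
    word acts on b through its parity and its invariant [Tword] only. *)
Lemma word_split gs b : (forall g, g \in gs -> Rx form eps g) ->
  word form gs b = eps *~ ((-1) ^+ size gs * sgnA form eps b)
    + (pA form eps b + Tword form eps gs *~ (- 2 * sgnA form eps b)).
Proof.
elim: gs => [|g gs IH] hgs.
  rewrite /Tword big_ord0 mul0rz addr0 mul1r /=.
  by have [] := splittingP hA b.
have rT := radicalMz hA (- 2 * sgnA form eps b) (Tword_radical hA gs).
have rb := radicalD hA (radical_p hA b) rT.
rewrite /= IH; last by move=> x xg; apply: hgs; rewrite inE xg orbT.
rewrite (refl_split hA); last by apply: hgs; rewrite mem_head.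
rewrite (sgnAE hA) // (pAE hA) // (Tword_cons form eps) mulrzDl -mulrzA.
rewrite exprS mulN1r !mulNr; congr (_ + _).
rewrite -addrA; congr (_ + _); rewrite addrC -mulrNz; congr (_ *~ _ + _); lia.
Qed.

Lemma Pi0_Rx g : Pi0 eps sigma g -> Rx form eps g.
Proof.
case=> [->|[i ->]].
- by exists 0; [exact: (Defs.form0l hA)|left; rewrite addr0].
- by exists (sigma i); [exact: radical_sigma|right; rewrite addrC].
Qed.

Lemma Tword_eps_cons gs : Tword form eps (eps :: gs) = Tword form eps gs.
Proof.
have h0 : pA form eps eps = 0.
  rewrite -[X in pA _ _ X]mulr1z -[_ *~ 1]addr0 (pAE hA) //.
  exact: (Defs.form0l hA).
by rewrite Tword_cons h0 mul0rz add0r.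
Qed.

Lemma Tword_sigma_cons i gs : Tword form eps (sigma i - eps :: gs) =
  Tword form eps gs - sigma i *~ (-1) ^+ size gs.
Proof.
have ri := radical_sigma i.
have e : sigma i - eps = eps *~ (-1) + sigma i by rewrite mulrN1z addrC.
by rewrite Tword_cons e (sgnAE hA) // (pAE hA) // mulrN1 mulrNz addrC.
Qed.

(** With the normalization u = (-1)^n T the sign of the contribution of a new
    letter no longer depends on n: prefixing eps replaces u by - u, prefixing
    sigma_i - eps replaces it by unitvec i - u.  So each letter exchanges the two
    positive parts and enlarges at most one of them, by at most one, which is
    how n |-> (uphalf n, n./2) evolves. *)
Lemma Tword_Pi0_bound gs : (forall g, g \in gs -> Pi0 eps sigma g) ->
  exists u, [/\ Tword form eps gs = zcomb sigma u *~ (-1) ^+ size gs,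
    (pospart u <= uphalf (size gs))%N & (pospart (- u)%R <= (size gs)./2)%N].
Proof.
elim: gs => [|g gs IH] hgs.
  exists 0; split; first by rewrite /Tword big_ord0 zcomb0 mul0rz.
    by rewrite /pospart big1 // => i _; rewrite ffunE.
  by rewrite oppr0 /pospart big1 // => i _; rewrite ffunE.
have [u [Tu up un]] := IH (fun x xg => hgs x (mem_behead (s := g :: gs) xg)).
have [->|[i ->]] := hgs g (mem_head _ _).
- exists (- u); rewrite opprK Tword_eps_cons Tu zcombN; split=> /=.
  + by rewrite exprS mulN1r mulrNz mulNrz opprK.
  + by lia.
  + by lia.
- have [h1 h2] := pospart_unitvec_sub_le u i.
  exists (unitvec i - u).
  rewrite Tword_sigma_cons Tu zcombD zcombN zcomb_unitvec; split=> /=.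
  + by rewrite exprS mulN1r mulrNz mulrzBl opprB.
  + by apply: leq_trans h1 _.
  + exact: leq_trans h2 up.
Qed.

(** Greedy choice of the first letter: if u has a positive coordinate i, then
    u = unitvec i - u' where u' = unitvec i - u has the positive parts of u
    exchanged, the first one being lowered by one, so a word for u' can be
    prefixed by sigma_i - eps; otherwise eps is prefixed, and the bound that
    shrinks when a letter is removed is the one on the positive part that
    vanishes. *)
Lemma Tword_Pi0_exists n u :
  (pospart u <= uphalf n)%N -> (pospart (- u)%R <= n./2)%N ->
  exists gs, [/\ forall g, g \in gs -> Pi0 eps sigma g, size gs = n
    & Tword form eps gs = zcomb sigma u *~ (-1) ^+ n].
Proof.
elim: n u => [|n IH] u /= up un.
  exists [::]; split=> //.
  have -> : u = 0 by apply: pospart_eq0; apply/eqP; rewrite -leqn0.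
  by rewrite zcomb0 mul0rz /Tword big_ord0.
have [u0|/pospart_gt0 [i ui]] := posnP (pospart u).
- have [|| gs [hgs sgs Tgs]] := IH (- u); rewrite ?opprK; [lia..|].
  exists (eps :: gs); split=> [g||].
  + by rewrite inE => /orP [/eqP ->|/hgs //]; left.
  + by rewrite /= sgs.
  + by rewrite Tword_eps_cons Tgs zcombN exprS mulN1r mulrNz mulNrz.
- have [e1 e2] := pospart_unitvec_sub_eq ui.
  have [|| gs [hgs sgs Tgs]] := IH (unitvec i - u).
  + by rewrite e1.
  + by rewrite -ltnS e2.
  exists (sigma i - eps :: gs); split=> [g||].
  + by rewrite inE => /orP [/eqP ->|/hgs //]; right; exists i.
  + by rewrite /= sgs.
  + rewrite Tword_sigma_cons Tgs sgs zcombD zcombN zcomb_unitvec.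
    by rewrite exprS mulN1r mulrNz mulrzBl addrAC subrr add0r.
Qed.

(** The normalization by (-1)^n is undone here.  For odd n it exchanges the two
    positive parts together with their bounds; for even n both bounds are n./2. *)
Lemma Pi0_TwordP n m :
  (exists gs, [/\ forall g, g \in gs -> Pi0 eps sigma g, size gs = n
    & Tword form eps gs = zcomb sigma m]) <->
  (pospart m <= n./2)%N /\ (pospart (- m)%R <= uphalf n)%N.
Proof.
split=> [[gs [hgs <-]]|].
- have [u [-> up un]] := Tword_Pi0_bound hgs.
  rewrite -signr_odd; case: odd (odd_double_half (size gs)) => /= sE.
  + rewrite mulrN1z -zcombN => /(zcomb_inj hA) <-; rewrite opprK; lia.
  + rewrite mulr1z => /(zcomb_inj hA) <-; lia.
- move=> [mp mn]; case on: (odd n).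
  + have [|| gs [hgs sgs Tgs]] := @Tword_Pi0_exists n (- m); rewrite ?opprK //.
    exists gs; split=> //.
    by rewrite Tgs -signr_odd on mulrN1z zcombN opprK.
  + have [|| gs [hgs sgs Tgs]] := @Tword_Pi0_exists n m; [lia..|].
    by exists gs; split=> //; rewrite Tgs -signr_odd on mulr1z.
Qed.

(** The possible lengths n of fundamental expressions of w, read off from any
    expression of w in reflections: since w is determined by its sign and its
    invariant, only the parity of n and the two bounds matter. *)
Lemma Pi0_expressionP gs0 w n m : expression form (Rx form eps) w gs0 ->
  Tword form eps gs0 = zcomb sigma m ->
  (exists2 gs, expression form (Pi0 eps sigma) w gs & size gs = n) <->
  [/\ odd n = odd (size gs0), (pospart m <= n./2)%N
    & (pospart (- m)%R <= uphalf n)%N].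
Proof.
move=> ew Tm; split=> [[gs [hgs ewgs] sgs]|[on mp mn]].
- have egs : expression form (Rx form eps) w gs.
    by split=> // g /hgs /Pi0_Rx.
  have [sg Tg] := expression_indep hA egs ew.
  have [] := (Pi0_TwordP n m).1; first by exists gs; rewrite Tg.
  split=> //; apply/eqP; move: sg; rewrite -sgs -signr_odd -[RHS]signr_odd.
  by do 2!case: odd.
- have [gs [hgs sgs Tgs]] := (Pi0_TwordP n m).2 (conj mp mn).
  exists gs => //; split=> // b; have [hgs0 ->] := ew.
  rewrite !word_split // => [|g /hgs /Pi0_Rx //].
  by rewrite Tm Tgs sgs -signr_odd -on signr_odd.
Qed.

End FundamentalWords.

(** * The length formula *)

Theorem theorem2p12 (nu : nat) (A : zmodType) (form : A -> A -> rat)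
    (eps : A) (sigma : 'I_nu -> A) (hA : A1_lattice form eps sigma)
    (w : A -> A) (hw : weyl form eps w) :
  let h : int := ht form eps sigma (eps + TW form eps w) in
  let t : int := (signW form eps w == 1)%:Z in
  exists2 k : nat, is_length form eps sigma w k & k%:Z = `|h| - Num.sg h * t.
Proof.
have [gs0 ew] := (weylP hA w).1 hw.
pose m := coords sigma (Tword form eps gs0).
have Tm : Tword form eps gs0 = zcomb sigma m.
  by rewrite (zcomb_coords hA) //; exact: (Tword_radical hA).
have tE : (signW form eps w == 1) = ~~ odd (size gs0).
  by rewrite (signWE hA ew) -signr_odd; case: odd.
rewrite /= (TWE hA ew) Tm (ht_eps_zcomb hA) tE.
have minimal k : [/\ odd k = odd (size gs0), (pospart m <= k./2)%N
      & (pospart (- m)%R <= uphalf k)%N] ->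
    (forall n, [/\ odd n = odd (size gs0), (pospart m <= n./2)%N
      & (pospart (- m)%R <= uphalf n)%N] -> (k <= n)%N) ->
    is_length form eps sigma w k.
  move=> hk kmin; split; first exact/(Pi0_expressionP hA k ew Tm).
  move=> gs egs; apply: kmin; apply/(Pi0_expressionP hA _ ew Tm).
  by exists gs.
move: minimal; move: (pospart m) (pospart (- m)) (odd _) => p q b minimal.
case: leqP => pq.
(* The least n with p <= n./2, q <= uphalf n and parity b is 2p or 2p + 1. *)
- have -> : Num.sg (1 + 2 * p%:Z) = 1 by apply: gtr0_sg; lia.
  exists (2 * p + b)%N; last by case: (b); lia.
  by apply: minimal => [|n []]; case: (b) => /=; try split; lia.
(* Here q > p, and q <= uphalf n is the binding bound: 2q or 2q - 1. *)
- have -> : Num.sg (1 - 2 * q%:Z) = -1 by apply: ltr0_sg; lia.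
  exists (2 * q - b)%N; last by case: (b); lia.
  by apply: minimal => [|n []]; case: (b) => /=; try split; lia.
Qed.
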